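(* There is a family of matrices $C_{n}$, called Chet matrices, for which $\sum_{i}C_{n}(i,j)=1$ and $\sum_{j}C_{n}(i,j)=1$ for all $i,j$, and if $\phi(C_{n})$ is defined as for doubly stochastic matrices, \[ \phi(C_n)=\min_{S\subseteq[n],\,|S|\leq n/2}\frac{\sum\limits _{i\in S,j\in\overline{S}}C_{n}(i,j)}{|S|}, \] then for all $n$, \[ \phi(C_{n})\leq 2\cdot\dfrac{\Delta(C_{n})}{n}. \]
   Context: For an $n\times n$ matrix $R$ whose eigenvalues are ordered as $\lambda_{1}>\text{Re}\lambda_{2}\geq\dots\geq\text{Re}\lambda_{n}$ with $\lambda_1$ real positive, the spectral gap is $\Delta(R)=1-\text{Re}\lambda_{2}(R)/\lambda_{1}(R)$. The Chet matrix $C_n$ is the $n\times n$ matrix with: $C_n(i,i+1)=r$ for $1\leq i\leq n-1$; first column $C_n(i,1)=b_{i-1}$ for $1\leq i\leq n$; last row $C_n(n,j)=b_{n-j}$ for $1\leq j\leq n$; $C_n(i,j)=c_{i-j}$ for $2\leq j\leq i\leq n-1$; all other entries $0$. Here $b_i=1-r-\sum_{j=0}^{i-1}c_j$ for $0\leq i\leq n-2$ and $b_{n-1}=1-\sum_{i=0}^{n-2}b_i$. For $k=0,\dots,n-3$, inductively, $c_k$ is set (as a function of $r$) so that $\text{Tr}(C_n^{k+1})=1$; explicitly, $c_{k}=\dfrac{1-\text{Tr}(C_{n}|_{k})^{k+1}}{(n-k-2)(k+1)r^{k}}$, where $C_n|_k$ has the structure of $C_n$ with all $c_l$, $l\geq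 k$, and all $b_l$, $l\geq k+1$, set to $0$. Finally $r=(1/n)^{1/(n-1)}$. *)

(* Defs.v *)
(* All numbers live in algC (algebraic complex numbers):
   the Chet matrix has real algebraic entries, and its eigenvalues are the
   roots (with multiplicity) of its characteristic polynomial in algC. *)
From HB Require Import structures.
From mathcomp Require Import all_boot all_order all_algebra all_field.
Set Implicit Arguments. Unset Strict Implicit. Unset Printing Implicit Defensive.
Import Order.TTheory GRing.Theory Num.Theory Num.Def.
Local Open Scope ring_scope.

Definition spectral_gap (n : nat) (A : 'M[algC]_n) (d : algC) : Prop :=
  exists (l1 l2 : algC) (s : seq algC),
    char_poly A = \prod_(z <- l1 :: l2 :: s) ('X - z%:P) /\
    [/\ l1 \is Num.real, 0 < l1, 'Re l2 < l1,
        all (fun z => 'Re z <= 'Re l2) s &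
        d = 1 - 'Re l2 / l1].

Definition cut_ratio (n : nat) (A : 'M[algC]_n) (S : {set 'I_n}) : algC :=
  (\sum_(i in S) \sum_(j in ~: S) A i j) / #|S|%:R.

Definition admissible_set (n : nat) (S : {set 'I_n}) : bool :=
  (0 < #|S|)%N && (#|S| * 2 <= n)%N.

Definition edge_expansion (n : nat) (A : 'M[algC]_n) (x : algC) : Prop :=
  (exists2 S, admissible_set S & x = cut_ratio A S) /\
  (forall S, admissible_set S -> x <= cut_ratio A S).

(* 0-based indices: paper's C_n(I,J) is [chet_gen n r b c (I-1) (J-1)]. *)
Definition chet_gen (n : nat) (r : algC) (b c : nat -> algC) : 'M[algC]_n :=
  \matrix_(i < n, j < n)
    if j == i.+1 :> nat then r
    else if j == 0 :> nat then b i
    else if i == n.-1 :> nat then b (n.-1 - j)%N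
    else if (1 <= j <= i)%N && (i < n.-1)%N then c (i - j)%N
    else 0.

Definition bseq (n : nat) (r : algC) (c : nat -> algC) (i : nat) : algC :=
  if (i <= n - 2)%N then 1 - r - \sum_(j < i) c j
  else if i == n.-1 then 1 - \sum_(l < n.-1) (1 - r - \sum_(j < l) c j)
  else 0.

Definition trunc (f : nat -> algC) (m : nat) : nat -> algC :=
  fun l => if (l < m)%N then f l else 0.

Definition chet_trunc (n : nat) (r : algC) (c : nat -> algC) (k : nat)
  : 'M[algC]_n :=
  chet_gen n r (trunc (bseq n r c) k.+1) (trunc c k).

Definition chet_next (n : nat) (r : algC) (cs : seq algC) (k : nat) : algC :=
  (1 - \tr ((chet_trunc n r (fun l => nth 0 cs l) k) ^+ k.+1))
    / ((n - k - 2)%:R * k.+1%:R * r ^+ k).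

Fixpoint chet_cs (n : nat) (r : algC) (k : nat) : seq algC :=
  match k with
  | 0 => [::]
  | k'.+1 => rcons (chet_cs n r k') (chet_next n r (chet_cs n r k') k')
  end.

Definition chet_c (n : nat) (r : algC) (k : nat) : algC :=
  nth 0 (chet_cs n r k.+1) k.

(* r = (1/n)^(1/(n-1)) : the positive real (n-1)-th root of 1/n *)
Definition chet_r (n : nat) : algC := (n.-1).-root (n%:R^-1).

Definition chet (n : nat) : 'M[algC]_n :=
  let r := chet_r n in
  let c := chet_c n r in
  chet_gen n r (bseq n r c) c.

(* Main.v *)
(* The all-ones vector is a left and right eigenvector, so char_poly C = (X - 1) q,
   and C is lower Hessenberg with constant superdiagonal r, so q(1) = n r^(n-1) = 1
   by the choice of r. The choice of the c_k makes Tr C^k = 1 for 1 <= k <= n-2, i.e.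
   the first n - 2 power sums of the n - 1 roots of q vanish; by Newton's identities
   q = X^(n-1) + a, and q(1) = 1 forces a = 0. Hence the spectral gap is 1.
   The cut at the first n/2 indices is crossed by the single entry r, and Bernoulli's
   inequality gives r <= 1 - 1/n, which is what the rounding of n/2 requires. *)
Require Import Defs.
From HB Require Import structures.
From mathcomp Require Import all_boot all_order all_algebra all_field.
From mathcomp Require Import spectral zify ring.
Set Implicit Arguments. Unset Strict Implicit. Unset Printing Implicit Defensive.
Import Order.TTheory GRing.Theory Num.Theory Num.Def.
Local Open Scope ring_scope.

(** * Polynomials whose roots have vanishing power sums *)

Lemma deriv_prod_XsubC (F : fieldType) (s : seq F) :
  let q := \prod_(z <- s) ('X - z%:P) in
  q^`() = \sum_(z <- s) q %/ ('X - z%:P).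
Proof.
elim: s => [|y s IH] /=; first by rewrite !big_nil -[1]/(1%:P) derivC.
rewrite !big_cons derivM derivXsubC mul1r IH mulKp ?polyXsubC_eq0 //.
congr (_ + _); rewrite mulr_sumr big_seq [RHS]big_seq.
by apply: eq_bigr => z zs; rewrite -divp_mulA // dvdp_XsubCl root_prod_XsubC.
Qed.

(* With Q_z = q / (X - z), the sums S k l = \sum_z z^l (Q_z)_k satisfy
   S k l = S (k+1) (l+1) + p_l q_(k+1), and S k 0 = (k+1) q_(k+1). *)
Lemma coef_prod_XsubC_psum0 (F : fieldType) (s : seq F) :
  let q := \prod_(z <- s) ('X - z%:P) in
  [pchar F] =i pred0 ->
  (forall l, (0 < l < size s)%N -> \sum_(z <- s) z ^+ l = 0) ->
  forall k, (0 < k < size s)%N -> q`_k = 0.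
Proof.
move=> q charF psum0 [//|k] /= k_lt.
pose S k l := \sum_(z <- s) z ^+ l * (q %/ ('X - z%:P))`_k.
have S_rec i l : S i l = S i.+1 l.+1 + (\sum_(z <- s) z ^+ l) * q`_i.+1.
  rewrite /S mulr_suml -big_split /= big_seq [RHS]big_seq; apply: eq_bigr => z zs.
  have dvd_q : 'X - z%:P %| q by rewrite dvdp_XsubCl root_prod_XsubC.
  (* With Q_z = q / (X - z), coefficient i+1 of q = Q_z (X - z) is (Q_z)_i - z (Q_z)_(i+1). *)
  rewrite -[in X in _ = _ + _ * X](divpK dvd_q) mulrBr coefB coefMX coefMC /=.
  by rewrite exprS; ring.
have S_big i l : (size s <= i)%N -> S i l = 0.
  move=> si; rewrite /S big1 // => z _; rewrite nth_default ?mulr0 //.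
  apply: leq_trans si; rewrite size_divp ?polyXsubC_eq0 // size_XsubC.
  by rewrite size_prod_XsubC /= subn1.
(* Since the power sums vanish, S (k+t) t does not change with t > 0 until k + t reaches [size s],
   beyond the degree of every Q_z. *)
have S_diag t : (0 < t)%N -> S (k + t)%N t = 0.
  move=> t_gt0; elim/ltn_ind: {t}(size s - (k + t))%N {-2}t (erefl (size s - (k + t))%N) t_gt0.
  move=> d IH t dE t_gt0.
  have [?|kt_lt] := leqP (size s) (k + t)%N; first exact: S_big.
  rewrite S_rec psum0 ?mul0r ?addr0; last first.
    by rewrite t_gt0 (leq_ltn_trans _ kt_lt) ?leq_addl.
  rewrite -addnS; apply: (IH (size s - (k + t.+1))%N) => //.
  by rewrite -dE addnS ltn_sub2l.
(* Coefficient k of q' is computed twice: by differentiating, and as S k 0, where only p_0 =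
   [size s] survives. As k+1 < [size s], characteristic 0 leaves only q_(k+1) = 0. *)
have : q`_k.+1 *+ k.+1 = q`_k.+1 *+ size s.
  rewrite -coef_deriv deriv_prod_XsubC coef_sum.
  have -> : \sum_(z <- s) (q %/ ('X - z%:P))`_k = S k 0.
    by apply: eq_bigr => z _; rewrite expr0 mul1r.
  rewrite S_rec -addn1 S_diag // add0r.
  rewrite (eq_bigr (fun=> 1)) => [|z _]; last by rewrite expr0.
  by rewrite big_const_seq count_predT iter_addr_0 addn1 mulr_natl.
rewrite -(subnKC (ltnW k_lt)) mulrnDr => /esym/eqP.
rewrite addrC -subr_eq0 addrK -mulr_natr mulf_eq0 => /orP[/eqP //|].
rewrite pcharf0P // in charF.
by rewrite charF subn_eq0 leqNgt k_lt.
Qed.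

Lemma psum0_prod_XsubC (F : fieldType) (s : seq F) :
  [pchar F] =i pred0 ->
  (forall l, (0 < l < size s)%N -> \sum_(z <- s) z ^+ l = 0) ->
  (0 < size s)%N ->
  (\prod_(z <- s) ('X - z%:P)).[1] = 1 ->
  \prod_(z <- s) ('X - z%:P) = 'X^(size s).
Proof.
move=> charF psum0 s_gt0; set q := \prod_(_ <- _) _ => q1.
have sq : size q = (size s).+1 by rewrite size_prod_XsubC.
have qs : q`_(size s) = 1.
  by have /monicP := monic_prod_XsubC s xpredT id; rewrite lead_coefE sq.
have qE : q = (q`_0)%:P + 'X^(size s).
  apply/polyP => k; rewrite coefD coefC coefXn.
  case: (ltngtP k (size s)) => [k_lt|k_gt|->].
  - case: k k_lt => [|k] k_lt; rewrite addr0 //=.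
    by apply: coef_prod_XsubC_psum0.
  - by rewrite nth_default ?sq // gtn_eqF ?(leq_ltn_trans _ k_gt) // addr0.
  - by rewrite gtn_eqF // add0r.
move: q1; rewrite qE hornerD hornerC hornerXn expr1n => /eqP.
by rewrite -subr_eq0 addrK => /eqP->; rewrite add0r.
Qed.

(** * Characteristic polynomials and traces of powers *)

Lemma char_poly_similar (R : comUnitRingType) n (P A B : 'M[R]_n) :
  P \in unitmx -> P *m A = B *m P -> char_poly A = char_poly B.
Proof.
move=> Pu PA; rewrite /char_poly /char_poly_mx.
pose Q := map_mx (@polyC R) P.
have Qu : \det Q * \det (map_mx (@polyC R) (invmx P)) = 1.
  by rewrite -det_mulmx -map_mxM mulmxV // map_mx1 det1.
have : \det (Q *m ('X%:M - map_mx (@polyC R) A)) =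
       \det (('X%:M - map_mx (@polyC R) B) *m Q).
  by rewrite mulmxBr mulmxBl -!map_mxM PA scalar_mxC.
rewrite !det_mulmx mulrC => E.
by rewrite -[LHS]mulr1 -[RHS]mulr1 -Qu !mulrA E.
Qed.

Lemma trigmx_expr (R : pzRingType) n (T : 'M[R]_n) k :
  is_trig_mx T ->
  is_trig_mx (T ^+ k) /\ forall i, (T ^+ k) i i = T i i ^+ k.
Proof.
move=> /is_trig_mxP Tt; elim: k => [|k [/is_trig_mxP IHt IHd]].
  split; first exact: scalar_mx_is_trig.
  by move=> i; rewrite !expr0 mxE eqxx.
rewrite exprS; split.
  apply/is_trig_mxP => i j ij; rewrite mxE big1 // => l _.
  have [il|li] := ltnP i l; first by rewrite Tt ?mul0r.
  by rewrite IHt ?mulr0 // (leq_ltn_trans li).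
move=> i; rewrite mxE (bigD1 i) //= IHd -exprS big1 ?addr0 // => l.
have [il|li|/val_inj->] := ltngtP i l; last by rewrite eqxx.
  by rewrite Tt ?mul0r.
by rewrite IHt ?mulr0.
Qed.

(** Schur triangularisation: [s] is the diagonal of a triangular matrix similar to [A], so the same
    list gives both the roots and the traces of all powers. *)
Lemma char_poly_mxtrace_expr (C : numClosedFieldType) n (A : 'M[C]_n) :
  (0 < n)%N ->
  exists s : seq C, [/\ size s = n, char_poly A = \prod_(z <- s) ('X - z%:P) &
                    forall k, \tr (A ^+ k) = \sum_(z <- s) z ^+ k].
Proof.
move=> n_gt0; have [P Pun simT] := Schur A n_gt0.
have Pu := unitarymx_unit Pun.
pose T := P *m A *m invmx P.
have Tt : is_trig_mx T by move: simT; rewrite /similar_to conjumx.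
have PA : P *m A = T *m P by rewrite mulmxKV.
have PAk k : P *m A ^+ k = T ^+ k *m P.
  elim: k => [|k IH]; first by rewrite !expr0 mulmx1 mul1mx.
  by rewrite exprS -[A * _]/(A *m _) mulmxA PA -mulmxA IH mulmxA exprS.
exists [seq T i i | i <- enum 'I_n]; split.
- by rewrite size_map size_enum_ord.
- by rewrite (char_poly_similar Pu PA) char_poly_trig // big_map big_enum.
- move=> k; rewrite big_map big_enum /=.
  rewrite -[A ^+ k](mulKmx Pu) PAk mxtrace_mulC mulmxK //.
  by apply: eq_bigr => i _; rewrite (trigmx_expr _ Tt).2.
Qed.

(** * Matrices with a constant outermost superdiagonal *)

(** For k = 1 this is a lower Hessenberg matrix with constant superdiagonal. Keeping k general makes
    the shape stable under products. *)
Definition upper_band (R : pzRingType) n k a (M : 'M[R]_n) :=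
  (forall i j : 'I_n, (i + k < j)%N -> M i j = 0) /\
  (forall i j : 'I_n, j = (i + k)%N :> nat -> M i j = a).

Lemma upper_band1 (R : pzRingType) n : upper_band 0 1 (1 : 'M[R]_n).
Proof.
split=> i j; rewrite addn0 mxE; last by move=> /val_inj->; rewrite eqxx.
by rewrite -val_eqE ltn_neqAle => /andP[/negPf->].
Qed.

(** A middle index h contributes only if j - l <= h <= i + k; for j = i + k + l this leaves h = i +
    k alone. *)
Lemma upper_bandM (R : pzRingType) n k l a b (M N : 'M[R]_n) :
  upper_band k a M -> upper_band l b N -> upper_band (k + l) (a * b) (M * N).
Proof.
move=> [M0 Ma] [N0 Nb]; split=> i j ij; rewrite mxE.
  rewrite big1 // => h _; have [hi|hi] := ltnP (i + k) h.
    by rewrite M0 ?mul0r.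
  by rewrite N0 ?mulr0 //; lia.
have h_lt : (i + k < n)%N by have := ltn_ord j; lia.
rewrite (bigD1 (Ordinal h_lt)) //= Ma // Nb ?ij ?addnA //.
rewrite big1 ?addr0 // => h; rewrite -val_eqE /= => hi.
have [?|?] := ltnP (i + k) h; first by rewrite M0 ?mul0r.
by rewrite N0 ?mulr0 //; lia.
Qed.

Lemma upper_bandX (R : pzRingType) n a (M : 'M[R]_n) k :
  upper_band 1 a M -> upper_band k (a ^+ k) (M ^+ k).
Proof.
move=> Ma; elim: k => [|k IH]; first exact: upper_band1.
by rewrite !exprS -add1n; apply: upper_bandM.
Qed.

(** In [D i j * M j i] the first factor needs i >= j + k and the second i <= j + k, so only i = j +
    k survives, where [M j i] is [a]. *)
Lemma mxtrace_upper_band (R : comPzRingType) n k a (D M : 'M[R]_n) :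
  (forall i j : 'I_n, (i < j + k)%N -> D i j = 0) -> upper_band k a M ->
  \tr (D *m M) = a * \sum_(i < n) \sum_(j < n | i == (j + k)%N :> nat) D i j.
Proof.
move=> D0 [M0 Ma]; rewrite mulr_sumr; apply: eq_bigr => i _.
rewrite mxE mulr_sumr [RHS]big_mkcond; apply: eq_bigr => j _ /=.
case: (ltngtP i (j + k)%N) => [ij|ij|ij].
- by rewrite D0 ?mul0r.
- by rewrite M0 ?mulr0.
- by rewrite (Ma j i) // mulrC.
Qed.

(* Telescoping: tr (C^(k+1)) - tr (A^(k+1)) = \sum_s tr (C^s (C - A) A^(k-s)),
   and each summand only sees the k-th subdiagonal of C - A. *)
Lemma mxtrace_expr_upper_band (R : comPzRingType) n k a (A C : 'M[R]_n) :
  upper_band 1 a A -> upper_band 1 a C ->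
  (forall i j : 'I_n, (i < j + k)%N -> C i j = A i j) ->
  \tr (C ^+ k.+1) =
    \tr (A ^+ k.+1)
    + a ^+ k * (\sum_(i < n) \sum_(j < n | i == (j + k)%N :> nat) (C i j - A i j)) *+ k.+1.
Proof.
move=> Aa Ca CA; set w := \sum_i _.
have trD M : upper_band k (a ^+ k) M -> \tr ((C - A) *m M) = a ^+ k * w.
  move=> /(@mxtrace_upper_band _ _ _ _ (C - A))->.
    by congr (_ * _); apply: eq_bigr => i _; apply: eq_bigr => j _; rewrite !mxE.
  by move=> i j ij; rewrite !mxE CA ?subrr.
(* [N] generalises A^(k+1-m): only its band is used, so the induction on m can absorb one factor [A]
   into it at each step. *)
suff tele m l N : (m + l = k.+1)%N -> upper_band l (a ^+ l) N ->
    \tr ((C ^+ m - A ^+ m) *m N) = a ^+ k * w *+ m.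
  have := tele k.+1 0%N 1 (addn0 _) (upper_band1 _ _).
  by rewrite mulmx1 raddfB /= => <-; rewrite addrC subrK.
elim: m l N => [|m IH] l N ml Nl.
  by rewrite !expr0 subrr mul0mx mxtrace0 mulr0n.
have -> : (C ^+ m.+1 - A ^+ m.+1) *m N =
          C ^+ m *m ((C - A) *m N) + (C ^+ m - A ^+ m) *m (A *m N).
  rewrite !mulmxA -mulmxDl; congr (_ *m _).
  by rewrite mulmxBr mulmxBl addrA subrK !exprSr.
rewrite mxtraceD (IH l.+1); first last.
- by rewrite -add1n exprS; apply: upper_bandM.
- by rewrite addnS.
(* Cyclicity of the trace puts [C ^+ m] behind [N], and that product has band l + m = k. *)
rewrite mxtrace_mulC -mulmxA trD; first by rewrite mulrS.
have -> : k = (l + m)%N by lia.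
by rewrite exprD; apply: upper_bandM => //; apply: upper_bandX.
Qed.

(* Adding all rows to the last one extracts 'X - 1 (column sums are 1); at
   'X = 1, adding all columns to the first one leaves a single entry n (row sums
   are 1), whose cofactor is triangular. *)
Lemma char_poly_stochastic_upper_band (R : comNzRingType) m (r : R) (A : 'M[R]_m.+1) :
  upper_band 1 r A ->
  (forall i, \sum_j A i j = 1) -> (forall j, \sum_i A i j = 1) ->
  exists2 q : {poly R}, char_poly A = ('X - 1%:P) * q &
                       q.[1] = m.+1%:R * r ^+ m.
Proof.
move=> [A0 Ar] row1 col1.
pose E := \matrix_(i < m.+1, j < m.+1)
  if i == ord_max then 1 else (i == j)%:R : {poly R}.
pose D := \row_(i < m.+1) if i == ord_max then 'X - 1%:P else 1 : {poly R}.
pose M := \matrix_(i < m.+1, j < m.+1)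
  if i == ord_max then 1 else char_poly_mx A i j.
have EM : E *m char_poly_mx A = diag_mx D *m M.
  apply/matrixP => i j; rewrite mul_diag_mx !mxE.
  have [->|ni] := eqVneq i ord_max.
    transitivity (\sum_k ('X%:M - map_mx polyC A) k j : {poly R}).
      by apply: eq_bigr => k _; rewrite !mxE eqxx mul1r.
    under eq_bigr => k _ do rewrite !mxE.
    rewrite sumrB -rmorph_sum col1 mulr1 (bigD1 j) //= eqxx mulr1n.
    by rewrite big1 ?addr0 // => k /negPf ->; rewrite mulr0n.
  rewrite mul1r (bigD1 i) //= !mxE (negPf ni) eqxx mul1r big1 ?addr0 // => k ki.
  by rewrite !mxE (negPf ni) eq_sym (negPf ki) mul0r.
have detE : \det E = 1.
  rewrite det_trig; last first.
    apply/is_trig_mxP => i j ij; rewrite mxE -!val_eqE /= !ltn_eqF //.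
    by have := ltn_ord j; lia.
  by rewrite big1 // => i _; rewrite mxE eqxx; case: ifP.
have detD : \det (diag_mx D) = 'X - 1%:P.
  rewrite det_diag (bigD1 ord_max) //= mxE eqxx big1 ?mulr1 // => i /negPf ni.
  by rewrite mxE ni.
exists (\det M).
  by rewrite -detD -det_mulmx -EM det_mulmx detE mul1r.
(* [N] is [M] evaluated at X = 1; multiplying it on the right by [F] below adds all columns to the
   first. *)
pose N := \matrix_(i < m.+1, j < m.+1)
  if i == ord_max then 1 else (i == j)%:R - A i j.
have -> : (\det M).[1] = \det N.
  rewrite -horner_evalE -det_map_mx; congr (\det _); apply/matrixP => i j.
  rewrite !mxE; case: ifP => _; first by rewrite rmorph1.
  by rewrite rmorphB rmorphMn /= !horner_evalE hornerX hornerC.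
pose F := \matrix_(i < m.+1, j < m.+1)
  if j == ord0 then 1 else (i == j)%:R : R.
have detF : \det F = 1.
  rewrite det_trig; last first.
    apply/is_trig_mxP => i j ij; rewrite mxE -!val_eqE /= gtn_eqF ?ltn_eqF //.
    by lia.
  by rewrite big1 // => i _; rewrite mxE eqxx; case: ifP.
have NF i j : (N *m F) i j =
    if j == ord0 then if i == ord_max then m.+1%:R else 0 else N i j.
  rewrite mxE; have [->|nj] := eqVneq j ord0; last first.
    rewrite (bigD1 j) //= !mxE (negPf nj) eqxx mulr1 big1 ?addr0 // => k kj.
    by rewrite !mxE (negPf nj) (negPf kj) mulr0.
  under eq_bigr => k _ do rewrite !mxE eqxx mulr1.
  have [_|_] := eqVneq i ord_max.
    by rewrite sumr_const card_ord.
  rewrite sumrB row1 (bigD1 i) //= eqxx big1 ?addr0 ?subrr // => k.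
  by rewrite eq_sym => /negPf->.
have -> : \det N = \det (N *m F) by rewrite det_mulmx detF mulr1.
rewrite (expand_det_col _ ord0).
rewrite (bigD1 ord_max) //= NF !eqxx big1 ?addr0; last first.
  by move=> i /negPf ni; rewrite NF ni eqxx mul0r.
(* The minor is lower triangular with diagonal -r, and its (-r)^m absorbs the cofactor sign
   (-1)^m. *)
congr (_ * _); rewrite /cofactor /= addn0 det_trig; last first.
  apply/is_trig_mxP => i j ij; rewrite 2!mxE NF mxE -!val_eqE /= /bump /=.
  have := ltn_ord i; have := ltn_ord j => jm im.
  rewrite leqNgt im /= add0n add1n /= !ltn_eqF //; last by lia.
  by rewrite A0 ?subr0 //= /bump; lia.
rewrite (eq_bigr (fun=> - r)).
  by rewrite prodr_const card_ord -exprMn mulN1r opprK.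
move=> i _; rewrite 2!mxE NF mxE -!val_eqE /= /bump /=.
have im := ltn_ord i.
rewrite leqNgt im /= add0n add1n /= !ltn_eqF //.
by rewrite Ar ?sub0r //= /bump; lia.
Qed.

(** * Coefficients of the Chet matrix, its symmetry and its line sums *)

Lemma mxOver_expr (R : pzRingType) (S : semiringClosed R) n (A : 'M[R]_n) k :
  A \is a mxOver S -> A ^+ k \is a mxOver S.
Proof.
move=> SA; elim: k => [|k IH]; last by rewrite exprS; apply: mxOverM.
by apply: mxOver_scalar; rewrite ?rpred0 ?rpred1.
Qed.

Lemma size_chet_cs n r k : size (chet_cs n r k) = k.
Proof. by elim: k => //= k IH; rewrite size_rcons IH. Qed.

Lemma nth_chet_cs n r k l : (l < k)%N -> (chet_cs n r k)`_l = chet_c n r l.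
Proof.
elim: k => // k IH; rewrite ltnS leq_eqVlt => /predU1P[->//|lk].
by rewrite /= nth_rcons size_chet_cs lk IH.
Qed.

Lemma chet_cE n r k : chet_c n r k = chet_next n r (chet_cs n r k) k.
Proof. by rewrite /chet_c /= nth_rcons size_chet_cs ltnn eqxx. Qed.

(** Makes [b] up to index k available at stage k of the recursion, when only the [c l] with l < k
    are known. *)
Lemma eq_bseq n r c c' i :
  (forall l, (l < i)%N -> c l = c' l) -> Defs.bseq n r c i = Defs.bseq n r c' i.
Proof.
move=> cc'; rewrite /Defs.bseq; case: ifP => _.
  by congr (_ - _); apply: eq_bigr => l _; rewrite cc'.
case: eqP => // iE; congr (1 - _); apply: eq_bigr => l _; congr (_ - _).
by apply: eq_bigr => j _; rewrite cc' // iE; have := ltn_ord l; have := ltn_ord j; lia.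
Qed.

Lemma upper_band_chet_gen n r b c : upper_band 1 r (chet_gen n r b c).
Proof.
split=> i j ij; rewrite mxE addn1 in ij *; last by rewrite ij eqxx.
have := ltn_ord j; have := ltn_ord i => ? ?.
by rewrite !ifF //; lia.
Qed.

(** Symmetry about the antidiagonal, which swaps the first column with the last row and so turns row
    sums into column sums. *)
Lemma chet_gen_rev n r b c i j :
  chet_gen n r b c (rev_ord j) (rev_ord i) = chet_gen n r b c i j.
Proof.
rewrite !mxE /=; have := ltn_ord j; have := ltn_ord i => i_n j_n.
have -> : (n - i.+1 == (n - j.+1).+1)%N = (j == i.+1 :> nat) by lia.
case: ifP => ji //; have -> : (n - i.+1 == 0)%N = (i == n.-1 :> nat) by lia.
have -> : (n - j.+1 == n.-1)%N = (j == 0 :> nat) by lia.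
have -> : (n.-1 - (n - i.+1) = i)%N by lia.
case: (eqVneq (i : nat) n.-1) => [->|ni].
  by case: eqVneq => [->|nj]; congr b; lia.
case: eqVneq => [//|nj].
have -> : ((0 < n - i.+1 <= n - j.+1) && (n - j.+1 < n.-1))%N =
          ((0 < j <= i) && (i < n.-1))%N by lia.
by case: ifP => // h; congr c; lia.
Qed.

(** Above the last row, [b i] is what [r] and c_0, ..., c_(i-1) leave of 1. The last row contains
    each of b_0, ..., b_(n-1) once, and b_(n-1) is chosen to complete their sum. *)
Lemma chet_gen_row_sum n r c (i : 'I_n) :
  (2 <= n)%N -> \sum_j chet_gen n r (Defs.bseq n r c) c i j = 1.
Proof.
move=> n2; set b := Defs.bseq n r c; have i_n := ltn_ord i.
under eq_bigr => j _ do rewrite mxE.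
pose f (j : nat) := if j == i.+1 then r else if j == 0%N then b i else
  if i == n.-1 :> nat then b (n.-1 - j)%N
  else if ((0 < j <= i) && (i < n.-1))%N then c (i - j)%N else 0.
rewrite -(big_mkord xpredT f) /f.
have [iE|ni] := eqVneq (i : nat) n.-1.
  rewrite (eq_big_nat _ _ (F2 := fun j => b (n.-1 - j)%N)); last first.
    move=> j /andP[_ jn]; rewrite ifF; last by lia.
    by case: eqVneq => // ->; rewrite iE subn0.
  rewrite big_nat_rev /=.
  rewrite (eq_big_nat _ _ (F2 := b)); last by move=> j ?; congr b; lia.
  have -> : n = n.-1.+1 by lia.
  rewrite big_nat_recr //= big_mkord {2}/b /Defs.bseq ifF; last by lia.
  rewrite eqxx /= addrC.
  rewrite [X in _ + X](eq_bigr (fun l : 'I_n.-1 => 1 - r - \sum_(j < l) c j)).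
    by rewrite subrK.
  by move=> l _; rewrite /b /Defs.bseq ifT //; have := ltn_ord l; lia.
have iS : (i.+1 < n)%N by lia.
rewrite (big_cat_nat (n := i.+1)) //= (big_cat_nat (m := i.+1) (n := i.+2)) //=.
rewrite big_nat1 eqxx [X in _ + (_ + X)]big_nat [X in _ + (_ + X)]big1; last first.
  by move=> j ?; rewrite !ifF //; lia.
rewrite addr0 big_nat_recl //= [X in _ + X + _](_ : _ = \sum_(j < i) c j).
  by rewrite /b /Defs.bseq ifT; [rewrite !subrK | lia].
rewrite -(big_mkord xpredT c) big_nat_rev; apply: eq_big_nat => j ji.
by rewrite ifF ?ifT; [congr c; lia | lia | lia].
Qed.

Lemma chet_gen_col_sum n r c (j : 'I_n) :
  (2 <= n)%N -> \sum_i chet_gen n r (Defs.bseq n r c) c i j = 1.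
Proof.
move=> n2; rewrite -(chet_gen_row_sum r c (rev_ord j) n2).
by rewrite (reindex_inj rev_ord_inj); apply: eq_bigr => i _; rewrite -chet_gen_rev rev_ordK.
Qed.

(** * Traces of powers of the Chet matrix *)

(** Strictly above the k-th subdiagonal only [r] and the [b l], [c l] with l < k occur, and these
    are already final at stage k. *)
Lemma chet_trunc_eq n r k (i j : 'I_n) : (k.+2 < n)%N -> (i < j + k)%N ->
  chet_gen n r (Defs.bseq n r (chet_c n r)) (chet_c n r) i j =
  chet_trunc n r (nth 0 (chet_cs n r k)) k i j.
Proof.
move=> kn ij; rewrite !mxE.
have bE l : (l <= k)%N -> Defs.bseq n r (chet_c n r) l =
    Defs.trunc (Defs.bseq n r (nth 0 (chet_cs n r k))) k.+1 l.
  move=> lk; rewrite /Defs.trunc ltnS lk; apply: eq_bseq => h hl.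
  by rewrite nth_chet_cs // (leq_trans hl).
case: ifP => // ji; case: ifP => j0; first by rewrite bE //; lia.
case: ifP => iE; first by rewrite bE //; lia.
case: ifP => // h; rewrite /Defs.trunc ifT; last by lia.
by rewrite nth_chet_cs //; lia.
Qed.

(** The two ends of the k-th subdiagonal, in the first column and the last row, carry b_k, which
    truncation keeps; the entries between them carry c_k, which it drops. *)
Lemma chet_trunc_diag n r k (i j : 'I_n) : (k.+2 < n)%N -> i = (j + k)%N :> nat ->
  chet_gen n r (Defs.bseq n r (chet_c n r)) (chet_c n r) i j -
  chet_trunc n r (nth 0 (chet_cs n r k)) k i j =
  if (k < i < n.-1)%N then chet_c n r k else 0.
Proof.
move=> kn ij; rewrite !mxE; have i_n := ltn_ord i.
have bE : Defs.bseq n r (chet_c n r) k =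
    Defs.trunc (Defs.bseq n r (nth 0 (chet_cs n r k))) k.+1 k.
  by rewrite /Defs.trunc ltnSn; apply: eq_bseq => h hl; rewrite nth_chet_cs.
have -> : (j == i.+1 :> nat) = false by lia.
case: eqVneq => [j0|nj].
  by rewrite ij j0 add0n bE subrr ltnn.
case: eqVneq => [iE|ni].
  have -> : (n.-1 - j = k)%N by lia.
  by rewrite bE subrr ifF //; lia.
rewrite !ifT; [|lia|lia|lia].
have -> : (i - j = k)%N by lia.
by rewrite /Defs.trunc ltnn subr0.
Qed.

(** Passing from the truncation to the full matrix adds (k+1) r^k (n-k-2) c_k to the trace, and
    [chet_next] solves the resulting linear equation for c_k. *)
Lemma mxtrace_chet_gen n (r : algC) k : (k.+2 < n)%N -> r != 0 ->
  \tr (chet_gen n r (Defs.bseq n r (chet_c n r)) (chet_c n r) ^+ k.+1) = 1.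
Proof.
move=> kn r0; set C := chet_gen _ _ _ _.
pose A := chet_trunc n r (nth 0 (chet_cs n r k)) k.
rewrite (@mxtrace_expr_upper_band _ _ k r A C); first last.
- by move=> i j; apply: chet_trunc_eq.
- exact: upper_band_chet_gen.
- exact: upper_band_chet_gen.
rewrite (_ : \sum_(i < n) _ = (n - k - 2)%:R * chet_c n r k).
  rewrite chet_cE /chet_next -/A -mulr_natr.
  have nk0 : (n - k - 2)%:R != 0 :> algC by rewrite pnatr_eq0; lia.
  have k0 : k.+1%:R != 0 :> algC by rewrite pnatr_eq0.
  rewrite mulrCA mulrA mulrAC -mulrA [_ * (r ^+ k)]mulrC.
  set t := \tr _; set x := (n - k - 2)%:R in nk0 *; set y := k.+1%:R in k0 *.
  rewrite [X in _ + X](_ : _ = 1 - t); first by rewrite addrC subrK.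
  clearbody x y t.
  by field; rewrite nk0 k0 expf_neq0.
transitivity (\sum_(i < n) if (k < i < n.-1)%N then chet_c n r k else 0).
  apply: eq_bigr => i _; have [ki|ik] := ltnP k i; last first.
    rewrite big1 // => j /eqP ij; rewrite chet_trunc_diag // ifF //; lia.
  have jn : (i - k < n)%N by have := ltn_ord i; lia.
  rewrite (big_pred1 (Ordinal jn)) => [|j].
    by rewrite chet_trunc_diag ?ki //= subnK // ltnW.
  by rewrite /= -(inj_eq val_inj) /=; lia.
(* The interior rows k+1, ..., n-2 number n-k-2. *)
rewrite -(big_mkord xpredT (fun i => if (k < i < n.-1)%N then chet_c n r k else 0)).
rewrite (big_cat_nat (n := k.+1)) ?leq0n //=; last by lia.
rewrite big_nat big1 ?add0r; last by move=> i ?; rewrite ifF //; lia.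
rewrite (big_cat_nat (n := n.-1)) /=; [|lia|lia].
rewrite [X in _ + X]big_nat [X in _ + X]big1 ?addr0; last first.
  by move=> i ?; rewrite ifF //; lia.
rewrite (eq_big_nat _ _ (F2 := fun=> chet_c n r k)); last by move=> i ->.
by rewrite sumr_const_nat mulr_natl; congr (_ *+ _); lia.
Qed.

(** * Realness of the entries *)

Lemma chet_gen_real n r b c : r \is Num.real ->
  (forall l, b l \is Num.real) -> (forall l, c l \is Num.real) ->
  chet_gen n r b c \is a mxOver (Num.real : {pred algC}).
Proof.
move=> rr br cr; apply/mxOverP => i j; rewrite mxE.
by do 4![case: ifP => // _]; rewrite rpred0.
Qed.

Lemma bseq_real n r c i : r \is Num.real -> (forall l, c l \is Num.real) ->
  Defs.bseq n r c i \is Num.real.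
Proof.
move=> rr cr; have S l : 1 - r - \sum_(j < l) c j \is Num.real.
  by rewrite !rpredB ?rpred1 // rpred_sum.
rewrite /Defs.bseq; case: ifP => // _; case: ifP => _; last exact: rpred0.
by rewrite rpredB ?rpred1 // rpred_sum.
Qed.

Lemma chet_c_real n r k : r \is Num.real -> chet_c n r k \is Num.real.
Proof.
move=> rr; elim/ltn_ind: k => k IH; rewrite chet_cE /chet_next.
have cr l : (chet_cs n r k)`_l \is Num.real.
  have [lk|kl] := ltnP l k; first by rewrite nth_chet_cs ?IH.
  by rewrite nth_default ?size_chet_cs // rpred0.
have tr m f l : (forall l, f l \is Num.real) -> Defs.trunc f m l \is @Num.real algC.
  by move=> fr; rewrite /Defs.trunc; case: ifP => // _; exact: rpred0.
rewrite rpred_div ?rpredM ?rpredX ?realn // rpredB ?rpred1 // rpred_sum // => i _.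
apply: (mxOverP _); apply: mxOver_expr; apply: chet_gen_real => // l; apply: tr => // h.
exact: bseq_real.
Qed.

(** * The size of r *)

Lemma bernoulli_sub (R : numDomainType) (x : R) m :
  0 <= x <= 1 -> 1 - m%:R * x <= (1 - x) ^+ m.
Proof.
case/andP => x0 x1; elim: m => [|m IH]; first by rewrite mul0r subr0 expr0.
rewrite exprS; apply: (@le_trans _ _ ((1 - x) * (1 - m%:R * x))).
  rewrite -subr_ge0.
  have -> : (1 - x) * (1 - m%:R * x) - (1 - m.+1%:R * x) = m%:R * x ^+ 2.
    by rewrite -natr1; ring.
  by rewrite mulr_ge0 ?exprn_ge0 ?ler0n.
by rewrite ler_wpM2l ?subr_ge0.
Qed.

Lemma chet_r_ge0 n : (2 <= n)%N -> 0 <= chet_r n.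
Proof. by move=> n2; rewrite rootC_ge0 ?invr_ge0 ?ler0n //; lia. Qed.

Lemma chet_rX n : (2 <= n)%N -> chet_r n ^+ n.-1 = n%:R^-1.
Proof. by move=> n2; rewrite rootCK //; lia. Qed.

Lemma chet_r_neq0 n : (2 <= n)%N -> chet_r n != 0.
Proof.
move=> n2; apply/eqP => r0; have := chet_rX n2.
rewrite r0 expr0n (_ : (n.-1 == 0)%N = false); last by lia.
by move/esym/eqP; rewrite invr_eq0 pnatr_eq0; lia.
Qed.

(** Comparing (n-1)-th powers, the claim is 1/n <= (1 - 1/n)^(n-1), and 1/n = 1 - (n-1)/n is
    Bernoulli's lower bound at x = 1/n. *)
Lemma chet_r_le n : (2 <= n)%N -> chet_r n <= n.-1%:R / n%:R.
Proof.
move=> n2; have n0 : n%:R != 0 :> algC by rewrite pnatr_eq0; lia.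
have E : n.-1%:R / n%:R = 1 - n%:R^-1 :> algC.
  by rewrite -subn1 natrB ?mulrBl ?mul1r ?divff //; lia.
have n1 : (0 < n.-1)%N by lia.
rewrite -(ler_pXn2r n1) ?nnegrE ?chet_r_ge0 ?divr_ge0 ?ler0n //.
rewrite chet_rX //; apply: le_trans (_ : 1 - n.-1%:R * n%:R^-1 <= _).
  by rewrite E opprB addrC subrK.
rewrite [in X in _ <= X]E; apply: bernoulli_sub.
by rewrite invr_ge0 ler0n invf_le1 ?ler1n ?ltr0n //=; lia.
Qed.

Lemma chet_real n : (2 <= n)%N -> chet n \is a mxOver (Num.real : {pred algC}).
Proof.
move=> n2; have rr : chet_r n \is Num.real by rewrite ger0_real ?chet_r_ge0.
have cr l := chet_c_real n l rr.
by apply: chet_gen_real => // l; apply: bseq_real.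
Qed.

(** * Spectrum and spectral gap *)

Lemma char_poly_chet n : (2 <= n)%N ->
  char_poly (chet n) = ('X - 1%:P) * 'X^(n.-1).
Proof.
case: n => [//|m] m1; have r0 := chet_r_neq0 m1.
have band : upper_band 1 (chet_r m.+1) (chet m.+1) by exact: upper_band_chet_gen.
have [q chi_q q1] := char_poly_stochastic_upper_band band
  (fun i => chet_gen_row_sum _ _ i m1) (fun j => chet_gen_col_sum _ _ j m1).
have [s [size_s chi_s tr_s]] := char_poly_mxtrace_expr (chet m.+1) (ltn0Sn m).
have s1 : 1 \in s.
  by rewrite -root_prod_XsubC -chi_s chi_q rootM root_XsubC eqxx.
have s_perm := perm_to_rem s1.
have size_s' : size (rem 1 s) = m by rewrite size_rem // size_s.
have qE : q = \prod_(z <- rem 1 s) ('X - z%:P).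
  have X1 : 'X - 1%:P != 0 :> {poly algC} by rewrite polyXsubC_eq0.
  apply: (mulfI X1); rewrite -chi_q chi_s.
  by rewrite (perm_big _ s_perm) big_cons.
rewrite chi_q qE psum0_prod_XsubC ?size_s' //.
- exact: pchar_num.
(* The exponents needed, 1 to n-2, are exactly those whose trace is normalised to 1; the removed
   eigenvalue 1 accounts for all of it. *)
- case=> // l /= lm.
  have : \tr (chet m.+1 ^+ l.+1) = 1 by apply: mxtrace_chet_gen => //; lia.
  rewrite tr_s (perm_big _ s_perm) big_cons expr1n => /eqP.
  by rewrite -subr_eq0 addrAC subrr add0r => /eqP.
- by rewrite -qE q1 chet_rX // divff // pnatr_eq0.
Qed.

Lemma spectral_gap_chet n : (2 <= n)%N -> spectral_gap (chet n) 1.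
Proof.
case: n => [|[|n]] // n2; exists 1, 0, (nseq n 0); split.
  rewrite char_poly_chet // !big_cons subr0 big_nseq subr0 /= exprS; congr (_ * (_ * _)).
  by rewrite iter_mulr_1.
rewrite rpred1 ltr01 raddf0 mul0r subr0; split=> //.
by apply/allP => z /nseqP[-> _]; rewrite raddf0.
Qed.

(** * Edge expansion and the initial cut *)

Lemma cut_ratio_real n (A : 'M[algC]_n) S :
  A \is a mxOver (Num.real : {pred algC}) -> cut_ratio A S \is Num.real.
Proof.
move=> /mxOverP Ar; rewrite rpred_div ?realn // rpred_sum // => i _.
by rewrite rpred_sum.
Qed.

(** The order on [algC] is partial; real entries make the finitely many cut ratios comparable, so a
    minimum is attained. *)
Lemma edge_expansion_exists n (A : 'M[algC]_n) S0 :
  A \is a mxOver (Num.real : {pred algC}) -> admissible_set S0 ->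
  exists2 phi, edge_expansion A phi & phi <= cut_ratio A S0.
Proof.
move=> Ar S0a; have Fr : {in @admissible_set n, forall S, cut_ratio A S \is Num.real}.
  by move=> S _; apply: cut_ratio_real.
have [S Sa Smin] := real_arg_minP S0a Fr.
by exists (cut_ratio A S); [split; first exists S | apply: Smin].
Qed.

(** Every crossing entry lies above the diagonal, and only the one at (k-1, k) lies on the first
    superdiagonal. *)
Lemma sum_cut_initial n (a : algC) (A : 'M[algC]_n) k : (0 < k < n)%N ->
  upper_band 1 a A ->
  \sum_(i in [set i : 'I_n | (i < k)%N])
    \sum_(j in ~: [set i : 'I_n | (i < k)%N]) A i j = a.
Proof.
move=> /andP[k0 kn] [A0 Aa]; have k1n : (k.-1 < n)%N by lia.
rewrite (bigD1 (Ordinal k1n)) ?inE /=; last by lia.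
rewrite (bigD1 (Ordinal kn)) ?inE /=; last by rewrite ltnn.
rewrite Aa /= ?addn1 ?prednK // !big1 ?addr0 //.
  move=> i; rewrite inE -val_eqE /= => ik; rewrite big1 // => j.
  by rewrite !inE => jk; rewrite A0 //; lia.
by move=> j; rewrite !inE -val_eqE /= => jk; rewrite A0 //=; lia.
Qed.

Theorem theorem1p3 (n : nat) (hn : (2 <= n)%N) :
  (forall i : 'I_n, \sum_(j < n) chet n i j = 1) /\
  (forall j : 'I_n, \sum_(i < n) chet n i j = 1) /\
  exists phi d : algC,
    [/\ edge_expansion (chet n) phi, spectral_gap (chet n) d &
        phi <= 2 * d / n%:R].
Proof.
split=> [i|]; first exact: chet_gen_row_sum.
split=> [j|]; first exact: chet_gen_col_sum.
pose k := n./2; have k0 : (0 < k)%N by rewrite /k; lia.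
pose S0 := [set i : 'I_n | (i < k)%N].
have kn : (k <= n)%N by rewrite /k; lia.
have card_S0 : #|S0| = k.
  rewrite -sum1_card (eq_bigl (fun i : 'I_n => (i < k)%N)); last by move=> i; rewrite inE.
  by rewrite -(big_ord_widen n (fun=> 1%N) kn) sum1_card card_ord.
have S0a : admissible_set S0 by rewrite /admissible_set card_S0 k0 /k; lia.
have [phi phiP phi_le] := edge_expansion_exists (chet_real hn) S0a.
exists phi, 1; split=> //; first exact: spectral_gap_chet.
apply: le_trans phi_le _; rewrite mulr1 /cut_ratio card_S0.
rewrite (sum_cut_initial (a := chet_r n)); first last.
- exact: upper_band_chet_gen.
- by rewrite k0 /k; lia.
(* With r <= (n-1)/n, the bound r/k <= 2/n reduces to n - 1 <= 2k, which holds for k = [n./2] in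
   both parities. *)
rewrite ler_pdivrMr ?ltr0n //; apply: le_trans (chet_r_le hn) _.
rewrite mulrAC -natrM ler_wpM2r ?invr_ge0 ?ler0n // ler_nat /k; lia.
Qed.
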